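(* Let $\Lambda_{TU}=\{(F(x),\Lambda_x,v(x))\}_{x\in X}$ be a continuous $(T,U)$-controlled $g$-fusion frame for $H$ with bounds $A,B$, and let $\Gamma_{TU}=\{(G(x),\Gamma_x,v(x))\}_{x\in X}$. Suppose there exists a constant $D$ with $$0<D\int_X v^2(x)\,d\mu_x<A$$ such that for each $f\in H$ (and $x\in X$) $$0\le\langle T^*(P_{G(x)}\Gamma_x^*\Gamma_xP_{G(x)}-P_{F(x)}\Lambda_x^*\Lambda_xP_{F(x)})Uf,f\rangle\le D\|f\|^2 .$$ Then $\Gamma_{TU}$ is a continuous $(T,U)$-controlled $g$-fusion frame for $H$.
   Context: $H$ is a separable Hilbert space, $\mathbb H$ is the collection of all closed subspaces of $H$, and $(X,\mu)$ is a measure space with positive measure $\mu$; $d\mu_x$ denotes integration with respect to $\mu$ in the variable $x$. $P_M$ is the orthogonal projection of $H$ onto a closed subspace $M$ (when followed by an operator defined on $M$ it is regarded as a map $H\to M$; its adjoint is then the inclusion $M\to H$). An operator is positive if it is self-adjoint and $\langle Sf,f\rangle\ge 0$ for all $f$; $\mathcal{GB}^+(H)$ is the set of positive bounded operators on $H$ with bounded inverse. Here $T,U\in\mathcal{GB}^+(H)$; $F,G:X\to\mathbb H$ are weakly measurable (for each $f\in H$, $x\mapsto P_{F(x)}f$ and $x\mapsto P_{G(x)}f$ are measurable); $v:X\to\mathbb R^+$ is measurable; $\{K_x\}_{x\in X}$ are Hilbert spaces; and $\Lambda_x:F(x)\to K_x$, $\Gamma_x:G(x)\to K_x$ are bounded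 linear for each $x\in X$. $\Lambda_{TU}$ is a continuous $(T,U)$-controlled $g$-fusion frame for $H$ with bounds $A,B$ ($0<A\le B<\infty$) if for all $f\in H$ $$A\|f\|^2\le\int_X v^2(x)\langle\Lambda_xP_{F(x)}Uf,\Lambda_xP_{F(x)}Tf\rangle\,d\mu_x\le B\|f\|^2 ;$$ $\Gamma_{TU}$ is a continuous $(T,U)$-controlled $g$-fusion frame for $H$ if the analogous inequalities hold for some positive finite constants with $G,\Gamma_x$ in place of $F,\Lambda_x$. The integrands occurring here are understood to be measurable. *)

(* Defs.v *)
From HB Require Import structures.
From mathcomp Require Import all_boot all_order all_algebra.
From mathcomp Require Import complex.
From mathcomp Require Import all_classical all_reals all_analysis.

Set Implicit Arguments.
Unset Strict Implicit.
Unset Printing Implicit Defensive.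

Import Order.TTheory GRing.Theory Num.Theory.
Import numFieldNormedType.Exports.

Local Open Scope classical_set_scope.
Local Open Scope ring_scope.

(* Hilbert spaces may be real or complex: the scalar field is selected by a
   [scalar_kind], and everything below is uniform in it. *)
Variant scalar_kind := RealScalars | ComplexScalars.

Definition scalars (R : realType) (k : scalar_kind) : numFieldType :=
  match k with RealScalars => R | ComplexScalars => R[i] end.

Section Scalars.
Variables (R : realType).

Definition conjs (k : scalar_kind) : scalars R k -> scalars R k :=
  match k with RealScalars => idfun | ComplexScalars => Num.conj end.

Definition of_real (k : scalar_kind) : R -> scalars R k :=
  match k with RealScalars => idfun | ComplexScalars => fun a => a%:C%C end.

Definition re_part (k : scalar_kind) : scalars R k -> R :=
  match k with RealScalars => idfun | ComplexScalars => @complex.Re R end.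

Definition im_part (k : scalar_kind) : scalars R k -> R :=
  match k with RealScalars => cst 0 | ComplexScalars => @complex.Im R end.

End Scalars.
Arguments of_real {R} k a.

(* The inner product is linear in its first argument. *)
HB.mixin Record NormedModule_isInner (R : realType) (k : scalar_kind) V
    & NormedModule (scalars R k) V := {
  inner : {dot V for @conjs R k} ;
  normr_inner : forall u : V, `|u| ^+ 2 = inner u u }.

#[short(type="innerType")]
HB.structure Definition Inner (R : realType) (k : scalar_kind) :=
  {V of NormedModule_isInner R k V & NormedModule (scalars R k) V}.

#[short(type="hilbertType")]
HB.structure Definition Hilbert (R : realType) (k : scalar_kind) :=
  {V of Inner R k V & CompleteNormedModule (scalars R k) V}.


Section ClosedSubspace.
Variables (R : realType) (k : scalar_kind) (H : hilbertType R k).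

Record closed_subspace := ClosedSubspace {
  carrier : set H ;
  carrier0 : carrier 0 ;
  carrierP : forall (a : scalars R k) u v,
    carrier u -> carrier v -> carrier (a *: u + v) ;
  carrier_closed : closed carrier }.

Definition csub_pred (M : closed_subspace) : {pred H} :=
  fun u => u \in carrier M.

Lemma csub_submod_closed M : GRing.submod_closed (csub_pred M).
Proof.
split=> [|a u v]; rewrite !unfold_in /=; first exact/mem_set/carrier0.
by move=> /set_mem Mu /set_mem Mv; apply/mem_set/carrierP.
Qed.

HB.instance Definition _ M :=
  GRing.isSubmodClosed.Build (scalars R k) H (csub_pred M)
    (csub_submod_closed M).

Definition csub (M : closed_subspace) := {u : H | csub_pred M u}.

End ClosedSubspace.

Coercion csub : closed_subspace >-> Sortclass.

Section ClosedSubspaceHilbert.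
Variables (R : realType) (k : scalar_kind) (H : hilbertType R k).
Variable M : closed_subspace H.

HB.instance Definition _ := SubChoice.on (csub M).
HB.instance Definition _ := [SubChoice_isSubLmodule of csub M by <:].

Let csub_normD (u v : M) : `|val (u + v)| <= `|val u| + `|val v|.
Proof. exact: ler_normD. Qed.

Let csub_normZ (a : scalars R k) (u : M) : `|val (a *: u)| = `|a| * `|val u|.
Proof. exact: normrZ. Qed.

Let csub_norm0 (u : M) : `|val u| = 0 -> u = 0.
Proof. by move=> /normr0_eq0 u0; apply/val_inj. Qed.

HB.instance Definition _ := Lmodule_isNormed.Build (scalars R k) (csub M)
  csub_normD csub_normZ csub_norm0.

Definition csub_inner (u v : M) : scalars R k := inner (val u) (val v).

Let csub_innerBl v : zmod_morphism (csub_inner ^~ v).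
Proof. by move=> u w; exact: linearBl. Qed.
Let csub_innerBr u : zmod_morphism (csub_inner u).
Proof. by move=> v w; exact: linearBr. Qed.
Let csub_innerZl v : scalable_for *%R (csub_inner ^~ v).
Proof. by move=> a u; exact: linearZl_LR. Qed.
Let csub_innerZr u : scalable_for (@conjs R k \; *%R) (csub_inner u).
Proof. by move=> a v; exact: linearZr_LR. Qed.

HB.instance Definition _ := isBilinear.Build (scalars R k) M M (scalars R k)
  *%R (@conjs R k \; *%R) csub_inner
  csub_innerBl csub_innerBr csub_innerZl csub_innerZr.

Let csub_inner_sym u v :
  csub_inner u v = (-1) ^+ false * @conjs R k (csub_inner v u).
Proof. exact: hermitian_subproof. Qed.

HB.instance Definition _ := isHermitianSesquilinear.Build (scalars R k) M
  false (@conjs R k) csub_inner csub_inner_sym.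

Let csub_inner_gt0 u : u != 0 -> 0 < csub_inner u u.
Proof. by move=> u0; apply: neq0_dnorm_gt0. Qed.

HB.instance Definition _ := isDotProduct.Build (scalars R k) M csub_inner
  csub_inner_gt0.

Let csub_normr_inner (u : M) : `|u| ^+ 2 = csub_inner u u.
Proof. exact: normr_inner. Qed.

HB.instance Definition _ := NormedModule_isInner.Build R k (csub M)
  csub_normr_inner.

Let csub_complete (F : set_system M) : ProperFilter F -> cauchy F -> cvg F.
Proof.
move=> FF /cauchyP Fc.
have val_ball (u v : M) (e : scalars R k) : ball u e v = ball (val u) e (val v).
  by rewrite -!ball_normE.
have Vc : cauchy (val @ F).
  apply: cauchy_exP => e /Fc [u Fu]; exists (val u).
  change (F (val @^-1` ball (val u) e)).
  by apply: filterS Fu => v /=; rewrite val_ball.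
have /cvg_ex [l Fl] : cvg (val @ F) by apply: cauchy_cvg.
have Ml : carrier M l.
  apply: (closed_cvg (carrier M) (carrier_closed (c := M)) _ l Fl).
  by apply: nearW => u; apply/set_mem/(valP u).
pose m : M := exist _ l (mem_set Ml).
apply/cvg_ex; exists m; apply/cvg_ballP => e e0.
move/cvg_ballP : Fl => /(_ e e0); apply: filterS => u lu.
by rewrite val_ball.
Qed.

HB.instance Definition _ := Uniform_isComplete.Build (csub M) csub_complete.

End ClosedSubspaceHilbert.

Section Operators.
Variables (R : realType) (k : scalar_kind).

Definition separable (T : topologicalType) :=
  exists2 A : set T, countable A & dense A.

Definition bounded_operator (V W : normedModType (scalars R k)) (f : V -> W) :=
  exists c : R, forall u, `|f u| <= of_real k c * `|u|.

(* Existence of the adjoint of a bounded operator is the Riesz representation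
   theorem; when no adjoint vector exists the value is the default point. *)
Definition adjoint (V W : hilbertType R k) (f : V -> W) (w : W) : V :=
  get [set v : V | forall u : V, inner (f u) w = inner u v].

Variable H : hilbertType R k.

(* P_M, with values in the subspace M itself; its adjoint, the inclusion of M
   in H, is [val]. *)
Definition orthproj (M : closed_subspace H) (u : H) : M :=
  get [set p : M | forall m : M, inner (u - val p) (val m) = 0].

Definition positive_operator (S : H -> H) :=
  adjoint S =1 S /\ forall f, 0 <= inner (S f) f.

Definition GBplus (T : {linear H -> H}) :=
  [/\ bounded_operator T, positive_operator T &
      exists S : {linear H -> H},
        [/\ bounded_operator S, cancel T S & cancel S T]].

(* P_M L^* L P_M as an operator on H *)
Definition local_frame_op (M : closed_subspace H) (V : hilbertType R k)
    (L : M -> V) (u : H) : H :=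
  val (orthproj M (val (adjoint L (L (orthproj M u))))).

End Operators.

Section ScalarIntegral.
Context d (X : measurableType d) (R : realType) (k : scalar_kind).
Variable mu : {measure set X -> \bar R}.
Implicit Types g : X -> scalars R k.

Definition scalar_measurable g :=
  measurable_fun [set: X] (@re_part R k \o g) /\
  measurable_fun [set: X] (@im_part R k \o g).

Definition scalar_integrable g :=
  mu.-integrable [set: X] (EFin \o @re_part R k \o g) /\
  mu.-integrable [set: X] (EFin \o @im_part R k \o g).

Definition scalar_integral g : scalars R k :=
  match k return (X -> scalars R k) -> scalars R k with
  | RealScalars => fun h => Rintegral mu [set: X] h
  | ComplexScalars => fun h =>
      (Rintegral mu [set: X] (fun x => complex.Re (h x)) +i*
       Rintegral mu [set: X] (fun x => complex.Im (h x)))%C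
  end g.

End ScalarIntegral.

Section ControlledFrame.
Context d (X : measurableType d) (R : realType) (k : scalar_kind).
Variables (mu : {measure set X -> \bar R}) (H : hilbertType R k).
Variables (T U : H -> H).
Variables (F : X -> closed_subspace H) (K : X -> hilbertType R k).
Variables (L : forall x, F x -> K x) (v : X -> R).

(* Measurability with respect to the norm-Borel sigma-algebra of H. *)
Definition weakly_measurable :=
  forall f : H, measurable_fun [set: X]
    ((fun x => val (orthproj (F x) f)) : X -> g_sigma_algebraType (@open H)).

Definition frame_integrand (f : H) (x : X) : scalars R k :=
  of_real k (v x ^+ 2) *
  inner (L (orthproj (F x) (U f))) (L (orthproj (F x) (T f))).

(* For complex scalars the inequalities are those of the partial order of
   R[i], so they also say that the integral is real. *)
Definition controlled_frame_bounds (A B : R) :=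
  0 < A <= B /\
  forall f : H, scalar_integrable mu (frame_integrand f) /\
    of_real k A * `|f| ^+ 2 <= scalar_integral mu (frame_integrand f)
                            <= of_real k B * `|f| ^+ 2.

Definition controlled_frame := exists A B : R, controlled_frame_bounds A B.

End ControlledFrame.

(* Main.v *)
Require Import Defs.
From HB Require Import structures.
From mathcomp Require Import all_boot all_order all_algebra.
From mathcomp Require Import all_classical all_reals all_analysis.
From mathcomp Require Import complex ring lra.

Import Order.TTheory GRing.Theory Num.Theory.
Import numFieldNormedType.Exports.

Local Open Scope classical_set_scope.
Local Open Scope ring_scope.

(** Write [T^* S_x U] for the operator attached to [x], where [S_x] is
    [P_{F x} Lambda_x^* Lambda_x P_{F x}] or its analogue for [Gamma].  Moving
    the adjoints to the other side of the inner product gives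
      [<T^* S_x U f, f> = <Lambda_x P_{F x} U f, Lambda_x P_{F x} T f>],
    so the frame integrand of [Gamma] at [f] is that of [Lambda] plus
    [v x ^ 2 * delta x] with [0 <= delta x <= D * |f| ^ 2].  As [v ^ 2] is
    integrable with integral [E] (the product [D * E] is positive and finite),
    integrating shows that [Gamma] is a frame with bounds [A] and [B + D * E].
    This is [frame_integrand_diff] followed by [scalar_integral_perturb].

    Moving adjoints across requires that the vectors selected by [adjoint] and
    [orthproj] exist ([adjointP], [orthprojP]).  Both follow from the Riesz
    representation theorem [riesz]: a bounded functional [phi <> 0] is
    represented by a multiple of the vector of least norm on the hyperplane
    [phi = 1].  That vector is the limit of the minimizing filter, which is
    Cauchy by the parallelogram law, and it is orthogonal to the kernel of
    [phi] because no translation along the kernel shortens it. *)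

(** * Real and complex scalars *)

Section Scalars.
Context {R : realType} {k : scalar_kind}.
Implicit Types (a b : R) (z w : scalars R k).

(** The partial order of [R[i]] compares only scalars with equal imaginary
    parts; this form lets an inequality between scalars be integrated
    componentwise. *)
Lemma les_part z w :
  (z <= w) = (im_part w == im_part z) && (re_part z <= re_part w).
Proof. by case: k z w => [z w|z w]; rewrite /= ?eqxx // lecE. Qed.

Lemma re_of_real a : re_part (of_real k a) = a.
Proof. by case: k. Qed.

Lemma im_of_real a : im_part (of_real k a) = 0.
Proof. by case: k. Qed.

Lemma of_realD a b : of_real k (a + b) = of_real k a + of_real k b.
Proof. by case: k => //=; rewrite rmorphD. Qed.

Lemma of_realM a b : of_real k (a * b) = of_real k a * of_real k b.
Proof. by case: k => //=; rewrite rmorphM. Qed.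

Lemma of_realX a n : of_real k (a ^+ n) = of_real k a ^+ n.
Proof. by case: k => //=; rewrite rmorphXn. Qed.

Lemma of_real0 : of_real k (0 : R) = 0.
Proof. by case: k. Qed.

Lemma re_partD z w : re_part (z + w) = re_part z + re_part w.
Proof. by case: k z w => //= [[? ?]] [? ?]. Qed.

Lemma im_partD z w : im_part (z + w) = im_part z + im_part w.
Proof. by case: k z w => [z w|[? ?] [? ?]] //=; rewrite addr0. Qed.

Lemma re_partMl a z : re_part (of_real k a * z) = a * re_part z.
Proof. by case: k z => //= [[x y]] /=; rewrite mul0r subr0. Qed.

Lemma of_real_le a b : (of_real k a <= of_real k b) = (a <= b).
Proof. by rewrite les_part !im_of_real eqxx !re_of_real. Qed.

Lemma of_real_lt a b : (of_real k a < of_real k b) = (a < b).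
Proof. by case: k => //=; rewrite ltcR. Qed.

Lemma ge0_of_real z : 0 <= z -> of_real k (re_part z) = z.
Proof.
by case: k z => //= [[x y]]; rewrite lecE /= => /andP[/eqP -> _].
Qed.

Lemma conjsM z w : conjs (z * w) = conjs z * conjs w.
Proof. by case: k z w => //= z w; rewrite rmorphM. Qed.

Lemma conjs0 : @conjs R k 0 = 0.
Proof. by case: k => //=; rewrite rmorph0. Qed.

Lemma conjsV z : conjs z^-1 = (conjs z)^-1.
Proof. by case: k z => //= z; rewrite fmorphV. Qed.

Lemma normCKs z : `|z| ^+ 2 = z * conjs z.
Proof.
by case: k z => /= z; [rewrite real_normK ?num_real // expr2 | rewrite normCK].
Qed.

End Scalars.

(** * Inner product spaces *)

Section InnerProduct.
Context {R : realType} {k : scalar_kind} {V : innerType R k}.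
Implicit Types (u v w : V) (a : scalars R k).

(** The norm takes its values in the scalar field; its real-valued version has
    infima and is accessible to real arithmetic. *)
Definition rnorm u : R := re_part `|u|.

Lemma rnormE u : of_real k (rnorm u) = `|u|.
Proof. exact: ge0_of_real. Qed.

Lemma rnorm_ge0 u : 0 <= rnorm u.
Proof. by rewrite -(of_real_le (k := k)) of_real0 rnormE. Qed.

Lemma rnormD u v : rnorm (u + v) <= rnorm u + rnorm v.
Proof.
rewrite -(re_of_real (k := k) (rnorm u)) rnormE.
rewrite -(re_of_real (k := k) (rnorm v)) rnormE -re_partD.
by have := ler_normD u v; rewrite les_part => /andP[].
Qed.

Lemma inner_conj u v : inner u v = conjs (inner v u).
Proof. by rewrite hermitian_subproof mul1r. Qed.

Lemma innerZl a u v : inner (a *: u) v = a * inner u v.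
Proof. exact: linearZl_LR. Qed.

Lemma innerZr a u v : inner u (a *: v) = conjs a * inner u v.
Proof. exact: linearZr_LR. Qed.

Lemma parallelogram u v :
  rnorm (u + v) ^+ 2 + rnorm (u - v) ^+ 2 = 2 * rnorm u ^+ 2 + 2 * rnorm v ^+ 2.
Proof.
have sqE w : rnorm w ^+ 2 = re_part (inner w w).
  by rewrite -normr_inner -rnormE -of_realX re_of_real.
rewrite !sqE -re_partD.
have -> : inner (u + v) (u + v) + inner (u - v) (u - v)
        = (inner u u + inner u u) + (inner v v + inner v v).
  rewrite !(linearDl, linearDr, linearNl, linearNr) /=.
  by move: (inner u u) (inner u v) (inner v u) (inner v v) => a b c d; ring.
by rewrite !re_partD; ring.
Qed.

(** Pythagoras for the component of [u] orthogonal to [w].  Nonnegativity of the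
    left-hand side is the Cauchy-Schwarz inequality, and comparison with [u]
    itself shows that a shortest vector is orthogonal to [w]. *)
Lemma norm_sub_proj u w : w != 0 ->
  `|u - (inner u w / inner w w) *: w| ^+ 2 =
  `|u| ^+ 2 - `|inner u w| ^+ 2 / `|w| ^+ 2.
Proof.
move=> w0; rewrite normCKs !normr_inner.
have b0 : inner w w != 0 by rewrite gt_eqF// neq0_dnorm_gt0.
rewrite linearBl !linearBr /= !innerZl !innerZr conjsM conjsV -!inner_conj.
by rewrite divfK// subrr subr0 mulrAC [inner w u * _]mulrC.
Qed.

Lemma cauchy_schwarz u w : `|inner u w| <= `|u| * `|w|.
Proof.
have [->|w0] := eqVneq w 0; first by rewrite linear0r !normr0 mulr0.
have : 0 <= `|u - (inner u w / inner w w) *: w| ^+ 2 by rewrite exprn_ge0.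
rewrite norm_sub_proj// subr_ge0 ler_pdivrMr ?exprn_gt0 ?normr_gt0//.
by rewrite -exprMn ler_pXn2r// nnegrE ?mulr_ge0.
Qed.

Lemma min_norm_orthogonal u w :
  (forall a, `|u| <= `|u - a *: w|) -> inner u w = 0.
Proof.
have [->|w0] := eqVneq w 0; first by rewrite linear0r.
move=> /(_ (inner u w / inner w w)).
rewrite -(ler_pXn2r (n := 2))// ?nnegrE// norm_sub_proj// lerBrDl.
rewrite gerDr pmulr_lle0 ?invr_gt0 ?exprn_gt0 ?normr_gt0// => uw0.
by apply/eqP; rewrite -normr_eq0 -sqrf_eq0 eq_le uw0 exprn_ge0.
Qed.

Lemma inner_ext u v : (forall w, inner w u = inner w v) -> u = v.
Proof.
move=> uv; apply/eqP; rewrite -subr_eq0 -normr_eq0 -sqrf_eq0 normr_inner.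
by rewrite linearBr /= uv subrr.
Qed.

End InnerProduct.

(** * The Riesz representation theorem *)

Section Riesz.
Context {R : realType} {k : scalar_kind} {V : hilbertType R k}.
Variable phi : {scalar V}.
Variable c : R.
Hypothesis phi_bounded : forall u, `|phi u| <= of_real k c * `|u|.

Let S := [set u | phi u = 1].
Let m := inf [set rnorm u | u in S].

(** If [u] and [w] on the hyperplane have norm close to the infimum [m], their
    midpoint is on it too and has norm at least [m], so the parallelogram law
    makes [u - w] small; completeness then provides the minimizer. *)
Lemma exists_min_norm :
  S !=set0 -> exists2 p, S p & forall u, S u -> `|p| <= `|u|.
Proof.
move=> [u0 Su0].
have lbS : lbound [set rnorm u | u in S] 0.
  by move=> _ [u _ <-]; exact: rnorm_ge0.
have mS : has_inf [set rnorm u | u in S].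
  by split; [exists (rnorm u0), u0 | exists 0].
have m_le u : S u -> m <= rnorm u.
  by move=> Su; apply: inf_lbound; [exists 0 | exists u].
have m0 : 0 <= m by apply: lb_le_inf => //; exists (rnorm u0), u0.
pose near_min e := [set u | S u /\ rnorm u < m + e].
pose F := filter_from [set e : R | 0 < e] near_min.
have FF : ProperFilter F.
  apply: filter_from_proper.
    apply: filter_from_filter; first by exists 1 => /=.
    move=> d e d0 e0; exists (Num.min d e); first by rewrite /= lt_min d0.
    by move=> u [Su]; rewrite -ltrBlDl lt_min !ltrBlDl => /andP[? ?]; split.
  move=> e e0; have [_ [u Su <-] ue] := inf_adherent e0 mS.
  by exists u.
have Fcauchy : cauchy F.
  apply: cauchy_exP => e' e'0.
  pose e := re_part e'.
  have ee : of_real k e = e' by apply: ge0_of_real; exact: ltW.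
  have e0 : 0 < e by rewrite -(of_real_lt (k := k)) of_real0 ee.
  (* With u and w of norm less than m + d, the parallelogram law gives
     |u - w|^2 < 4 (m + d)^2 - 4 m^2 = d (8 m + 4 d), at most d (8 m + 4)
     since d <= 1. *)
  pose d := Num.min 1 (e ^+ 2 / (8 * m + 5)).
  have d0 : 0 < d by rewrite lt_min ltr01 divr_gt0 ?exprn_gt0//; lra.
  have d1 : d <= 1 by rewrite ge_min lexx.
  have de : d * (8 * m + 5) <= e ^+ 2.
    by rewrite -ler_pdivlMr ?ge_min ?lexx ?orbT//; lra.
  have [_ [u Su <-] ue] := inf_adherent d0 mS.
  exists u, d => // w [Sw we]; rewrite -ball_normE /=.
  rewrite -ee -rnormE of_real_lt.
  have Shalf : S (2^-1 *: (u + w)).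
    by rewrite /S /= linearZ linearD /= Su Sw -[1 + 1]/(2%:R) mulVf ?pnatr_eq0.
  have := m_le _ Shalf.
  have -> : rnorm (2^-1 *: (u + w)) = rnorm (u + w) / 2.
    rewrite /rnorm normrZ.
    have -> : `|2^-1 : scalars R k| = of_real k (2^-1).
      rewrite ger0_norm ?invr_ge0//.
      by case: (k) => //=; rewrite fmorphV /= rmorph_nat.
    by rewrite re_partMl mulrC.
  have := parallelogram u w.
  have := rnorm_ge0 u; have := rnorm_ge0 w; have := rnorm_ge0 (u - w).
  move: ue we; rewrite -/m.
  set x := rnorm u; set y := rnorm w.
  set z := rnorm (u - w); set t := rnorm (u + w).
  move=> xm ym z0 y0 x0 pl tm.
  have t2 : 4 * m ^+ 2 <= t ^+ 2 by nra.
  have x2 : x ^+ 2 <= (m + d) ^+ 2 by nra.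
  have y2 : y ^+ 2 <= (m + d) ^+ 2 by nra.
  rewrite -(ltr_pXn2r (n := 2)) ?nnegrE ?(ltW e0)//.
  nra.
have /cvg_ex [p Fp] : cvg F by apply: cauchy_cvg.
have approx e :
    0 < e -> exists u, [/\ S u, rnorm u < m + e & rnorm (p - u) < e].
  move=> e0; have Be : F (ball p (of_real k e)).
    by apply: Fp; apply: nbhsx_ballx; rewrite -(of_real0 (k := k)) of_real_lt.
  have Ne : F (near_min e) by exists e.
  have [u [+ [Su ue]]] := filter_ex (filterI Be Ne).
  by rewrite -ball_normE /= -rnormE of_real_lt => pu; exists u.
exists p.
  (* |phi p - 1| = |phi (p - u)| <= c |p - u| for u on the hyperplane, and such
     u come arbitrarily close to p. *)
  apply/eqP; rewrite -subr_eq0 -normr_le0 -[`|_|]ge0_of_real//.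
  rewrite -(of_real0 (k := k)) of_real_le; apply/ler_addgt0Pr => e e0; rewrite add0r.
  have c0 : 0 < `|c| + 1 by rewrite ltr_wpDl.
  have [u [Su _ pu]] := approx _ (divr_gt0 e0 c0).
  have -> : phi p - 1 = phi (p - u) by rewrite linearB /= Su.
  rewrite -(of_real_le (k := k)) ge0_of_real//.
  apply: le_trans (phi_bounded _) _; rewrite -rnormE -of_realM of_real_le.
  move: pu; rewrite ltr_pdivlMr// => /ltW; apply: le_trans.
  rewrite mulrC ler_wpM2l ?rnorm_ge0//.
  by apply: le_trans (ler_norm _) _; rewrite lerDl.
move=> u Su; rewrite -!rnormE of_real_le; apply: le_trans (m_le _ Su).
apply/ler_addgt0Pr => e e0.
have e20 : 0 < e / 2 by rewrite divr_gt0.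
have [w [_ we pw]] := approx _ e20.
have := rnormD w (p - w); rewrite addrC subrK => pe.
lra.
Qed.

(** With [p] of least norm on [phi = 1], the vector [u - phi u *: p] lies in the
    kernel of [phi], hence is orthogonal to [p]; so
    [<u, p> = phi u * |p| ^ 2]. *)
Lemma riesz : exists v, forall u, phi u = inner u v.
Proof.
have [[u0 phiu0]|phi0] := pselect (exists u, phi u != 0); last first.
  exists 0 => u; rewrite linear0r; apply/eqP/negPn/negP => phiu.
  by apply: phi0; exists u.
have [|p Sp pmin] := exists_min_norm.
  by exists ((phi u0)^-1 *: u0); rewrite /S /= linearZ /= mulVf.
have ppp u : phi u = 0 -> inner u p = 0.
  move=> phiu; rewrite inner_conj min_norm_orthogonal ?conjs0//.
  move=> a; apply: pmin; rewrite /S /= linearB linearZ /= phiu mulr0 subr0.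
  exact: Sp.
have p0 : inner p p != 0.
  rewrite gt_eqF// neq0_dnorm_gt0//; apply/eqP => p0.
  by move: Sp; rewrite /S /= p0 linear0 => /eqP; rewrite eq_sym oner_eq0.
exists ((inner p p)^-1 *: p) => u.
have : inner (u - phi u *: p) p = 0.
  by apply: ppp; rewrite linearB linearZ /= Sp mulr1 subrr.
rewrite linearBl /= innerZl => /eqP; rewrite subr_eq0 => /eqP up.
by rewrite innerZr conjsV -inner_conj up mulrC mulfK.
Qed.

End Riesz.

(** * Adjoints, projections and local frame operators *)

Section Adjoint.
Context {R : realType} {k : scalar_kind}.

Lemma adjointP {V W : hilbertType R k} (f : {linear V -> W}) u w :
  bounded_operator f -> inner (f u) w = inner u (adjoint f w).
Proof.
move=> [c fc].
have phi_lin : linear_for *%R (fun u => inner (f u) w).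
  by move=> a x y; rewrite linearP linearDl /= innerZl.
pose phi : {scalar V} := HB.pack (fun u => inner (f u) w)
  (GRing.isLinear.Build (scalars R k) V (scalars R k) *%R _ phi_lin).
have [|v fv] := riesz phi (c * rnorm w).
  move=> x; apply: le_trans (cauchy_schwarz _ _) _.
  by rewrite of_realM rnormE mulrAC ler_wpM2r.
suff : [set v | forall u, inner (f u) w = inner u v] (adjoint f w) by apply.
by apply: getPex; exists v.
Qed.

Lemma adjointPl {V W : hilbertType R k} (f : {linear V -> W}) u w :
  bounded_operator f -> inner (adjoint f w) u = inner w (f u).
Proof. by move=> bf; rewrite inner_conj -adjointP// -inner_conj. Qed.

Variables (H : hilbertType R k).
Implicit Types M : closed_subspace H.

(** True by conversion; needed to rewrite, since the two inner products come
    from different canonical instances. *)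
Lemma csub_innerE M (p q : M) : inner p q = inner (val p) (val q).
Proof. by []. Qed.

(** The projection of [u] on [M] represents the functional [<-, u>] restricted
    to [M], which is a Hilbert space because it is closed. *)
Lemma orthprojP M u (m : M) :
  inner (val m) (val (orthproj M u)) = inner (val m) u.
Proof.
have phi_lin : linear_for *%R (fun m : M => inner (val m) u).
  by move=> a x y; rewrite linearP linearDl /= innerZl.
pose phi : {scalar M} := HB.pack (fun m : M => inner (val m) u)
  (GRing.isLinear.Build (scalars R k) M (scalars R k) *%R _ phi_lin).
have [|p up] := riesz phi (rnorm u).
  by move=> x; apply: le_trans (cauchy_schwarz _ _) _; rewrite rnormE mulrC.
suff orth : [set p : M | forall m : M, inner (u - val p) (val m) = 0]
    (orthproj M u).
  apply/eqP; rewrite eq_sym -subr_eq0 -linearBr /= inner_conj; apply/eqP.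
  by rewrite orth conjs0.
apply: getPex; exists p => q /=.
have := up q; rewrite /phi /= csub_innerE => upq.
by rewrite inner_conj linearBr /= upq subrr conjs0.
Qed.

Lemma orthproj_val M (m : M) : orthproj M (val m) = m.
Proof. by apply: inner_ext => q; exact: orthprojP. Qed.

(** The adjoint of [L] already lands in [M], so the outer projection acts as the
    identity; the factor [P_M] on [w] comes from the inclusion of [M]. *)
Lemma inner_local_frame_op M (V : hilbertType R k) (L : {linear M -> V}) u w :
  bounded_operator L ->
  inner (local_frame_op L u) w = inner (L (orthproj M u)) (L (orthproj M w)).
Proof.
move=> bL; rewrite /local_frame_op orthproj_val.
by rewrite -(adjointPl _ _ _ bL) csub_innerE orthprojP.
Qed.

End Adjoint.

Section Perturbation.
Context {R : realType} {k : scalar_kind} {H : hilbertType R k}.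
Context {d} {X : measurableType d} {K : X -> hilbertType R k}.
Variables (T U : {linear H -> H}) (F G : X -> closed_subspace H) (v : X -> R).
Variables (Lambda : forall x, {linear F x -> K x}).
Variables (Gamma : forall x, {linear G x -> K x}).
Hypothesis bT : bounded_operator T.
Hypothesis bLambda : forall x, bounded_operator (Lambda x).
Hypothesis bGamma : forall x, bounded_operator (Gamma x).

Lemma frame_integrand_diff f x :
  frame_integrand T U Gamma v f x = frame_integrand T U Lambda v f x +
  of_real k (v x ^+ 2) * inner (adjoint T (local_frame_op (Gamma x) (U f)
                                 - local_frame_op (Lambda x) (U f))) f.
Proof.
rewrite adjointPl// linearBl /= !inner_local_frame_op// /frame_integrand.
by rewrite -mulrDr addrC subrK.
Qed.

End Perturbation.

(** * Integrating the perturbation *)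

Section Integral.
Context {d} {X : measurableType d} {R : realType} {k : scalar_kind}.
Variable mu : {measure set X -> \bar R}.

Lemma re_scalar_integral (g : X -> scalars R k) :
  re_part (scalar_integral mu g) = Rintegral mu [set: X] (@re_part R k \o g).
Proof. by case: k g. Qed.

Lemma im_scalar_integral (g : X -> scalars R k) :
  im_part (scalar_integral mu g) = Rintegral mu [set: X] (@im_part R k \o g).
Proof. by case: k g => //= g; rewrite Rintegral_cst// mul0r. Qed.

(** The hypothesis forces [g] and [h] to have the same imaginary part, so only
    the real parts are perturbed, and [|Re g| + |w|] dominates that of [h]. *)
Lemma scalar_integral_perturb (g h : X -> scalars R k) (w : X -> R) :
  scalar_measurable h ->
  mu.-integrable [set: X] (EFin \o w) ->
  (forall x, g x <= h x <= g x + of_real k (w x)) ->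
  scalar_integrable mu g ->
  scalar_integrable mu h /\
  scalar_integral mu g <= scalar_integral mu h
    <= scalar_integral mu g + of_real k (Rintegral mu [set: X] w).
Proof.
move=> [mh _] iw gh [ig iig].
have im_eq : @im_part R k \o h = @im_part R k \o g.
  apply/funext => x /=; have /andP[] := gh x.
  by rewrite les_part => /andP[/eqP].
have lo x : re_part (g x) <= re_part (h x).
  by have /andP[] := gh x; rewrite !les_part => /andP[].
have hi x : re_part (h x) <= re_part (g x) + w x.
  have /andP[_] := gh x; rewrite les_part => /andP[_].
  by rewrite re_partD re_of_real.
have igw : mu.-integrable [set: X] (EFin \o (fun x => re_part (g x) + w x)).
  exact: (integrableD measurableT ig iw).
have ih : mu.-integrable [set: X] (EFin \o @re_part R k \o h).
  have idom := integrableD measurableT (integrable_abse ig) (integrable_abse iw).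
  apply: (le_integrable measurableT _ _ idom) => //.
    exact/measurable_realfun.measurable_EFinP.
  move=> x _; rewrite /= lee_fin.
  rewrite [leRHS]ger0_norm ?addr_ge0//.
  have w0 : 0 <= w x.
    by rewrite -(lerDl (re_part (g x))); exact: le_trans (hi x).
  rewrite (ger0_norm w0) ler_norml.
  have := lo x; have := hi x; have := ler_norm (re_part (g x)).
  have := lerNnormlW (lexx `|re_part (g x)|); lra.
split.
  by split=> //; rewrite -[_ \o h]/(EFin \o (@im_part R k \o h)) im_eq.
rewrite !les_part im_partD im_of_real addr0 !im_scalar_integral im_eq eqxx /=.
rewrite re_partD re_of_real !re_scalar_integral /=.
apply/andP; split; first by apply: le_Rintegral.
by rewrite -RintegralD//; apply: le_Rintegral.
Qed.

End Integral.

Theorem corollary5p2 (R : realType) (k : scalar_kind)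
  (H : hilbertType R k) (sepH : separable H)
  (d : measure_display) (X : measurableType d)
  (mu : {measure set X -> \bar R})
  (T U : {linear H -> H}) (hT : GBplus T) (hU : GBplus U)
  (F G : X -> closed_subspace H)
  (mF : weakly_measurable F) (mG : weakly_measurable G)
  (v : X -> R) (v_ge0 : forall x, 0 <= v x) (mv : measurable_fun [set: X] v)
  (K : X -> hilbertType R k)
  (Lambda : forall x, {linear F x -> K x})
  (Gamma : forall x, {linear G x -> K x})
  (bLambda : forall x, bounded_operator (Lambda x))
  (bGamma : forall x, bounded_operator (Gamma x))
  (mLambda : forall f, scalar_measurable (frame_integrand T U Lambda v f))
  (mGamma : forall f, scalar_measurable (frame_integrand T U Gamma v f))
  (A B : R)
  (frame_Lambda : controlled_frame_bounds mu T U Lambda v A B)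
  (D : R)
  (hD : (0 < D%:E * \int[mu]_x (v x ^+ 2)%:E < A%:E)%E)
  (hDiff : forall (f : H) (x : X),
    0 <= inner (adjoint T (local_frame_op (Gamma x) (U f)
                           - local_frame_op (Lambda x) (U f))) f
      <= of_real k D * `|f| ^+ 2) :
  controlled_frame mu T U Gamma v.
Proof.
have [bT _ _] := hT.
have [/andP[A0 AB] frameL] := frame_Lambda.
have v2_ge0 x : 0 <= v x ^+ 2 by rewrite exprn_ge0.
(* A product 0 < D * I < A with I >= 0 rules out both D <= 0 and I = +oo. *)
have [D0 v2_fin] : 0 < D /\ (\int[mu]_x (v x ^+ 2)%:E < +oo)%E.
  have I0 : (0 <= \int[mu]_x (v x ^+ 2)%:E)%E.
    by apply: integral_ge0 => x _; rewrite lee_fin.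
  move: hD I0; case: (integral mu _ _) => [r| |] //=.
    rewrite -EFinM !lte_fin lee_fin => /andP[Dr _] r0; rewrite ltry; split=> //.
    by rewrite ltNge; apply/negP => Dle0; move: Dr; rewrite ltNge mulr_le0_ge0.
  have [D0|D0|D0] := ltgtP 0 D.
  - by rewrite gt0_muley ?lte_fin// => /andP[_].
  - by rewrite lt0_muley ?lte_fin// => /andP[].
  - by move=> /andP[+ _] _; rewrite -D0 mul0e lte_fin => /lt_eqF; rewrite eqxx.
have iv2 : mu.-integrable [set: X] (EFin \o (fun x => v x ^+ 2)).
  apply/integrableP; split.
    apply/measurable_realfun.measurable_EFinP.
    exact: measurable_realfun.measurable_funX.
  under eq_integral do rewrite gee0_abs ?lee_fin//.
  exact: v2_fin.
pose E := Rintegral mu [set: X] (fun x => v x ^+ 2).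
have E0 : 0 <= E by apply: Rintegral_ge0.
exists A, (B + D * E); split.
  by rewrite A0 (le_trans AB)// lerDl mulr_ge0// ltW.
move=> f; have [iL /andP[lowL upL]] := frameL f.
pose c := D * rnorm f ^+ 2.
have cE : of_real k c = of_real k D * `|f| ^+ 2.
  by rewrite of_realM of_realX rnormE.
have iw : mu.-integrable [set: X] (EFin \o (fun x => c * v x ^+ 2)).
  exact: (integrableZl measurableT c iv2).
have diff x :
    frame_integrand T U Lambda v f x <= frame_integrand T U Gamma v f x <=
    frame_integrand T U Lambda v f x + of_real k (c * v x ^+ 2).
  have /andP[ge0 leD] := hDiff f x.
  have ov2 : 0 <= of_real k (v x ^+ 2).
    by rewrite -(of_real0 (k := k)) of_real_le.
  rewrite (frame_integrand_diff T U F G v Lambda Gamma)// lerDl mulr_ge0//=.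
  by rewrite lerD2l mulrC of_realM cE ler_wpM2r.
have [iG /andP[lowG upG]] :=
  scalar_integral_perturb mu _ _ _ (mGamma f) iw diff iL.
split=> //; rewrite (le_trans lowL lowG)/=; apply: le_trans upG _.
have -> : of_real k (B + D * E) * `|f| ^+ 2 =
    of_real k B * `|f| ^+ 2 + of_real k (\int[mu]_x (c * v x ^+ 2))%R.
  rewrite RintegralZl// -/E -rnormE -!of_realX -!of_realM -of_realD.
  by congr of_real; rewrite /c; ring.
by rewrite lerD2r.
Qed.
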